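(* Let $d\ge1$ be an integer and let $m_1,\dots,m_d$ be integers $\ge2$. Set $J=[0,1]^d$ and let $g:J\to J$ be the mapping $(x_1,\dots,x_d)\mapsto(m_1x_1\ (\mathrm{mod}\ 1),\dots,m_dx_d\ (\mathrm{mod}\ 1))$. Then the set $$\mathcal F(J,g)=\Big\{x\in J:\lim_{n\to\infty}\frac1n\sum_{k=0}^{n-1}g^kx=x\Big\}$$ is dense in $[0,1]^d$ and of full Hausdorff dimension, i.e. $\dim_H\mathcal F(J,g)=d$.
   Context: $g^k$ denotes the $k$-th iterate of $g$ and the averages are taken in $\mathbb R^d$. $\dim_H$ is Hausdorff dimension for the Euclidean metric. *)

(* Defs.v *)
From HB Require Import structures.
From mathcomp Require Import all_boot all_order all_algebra.
From mathcomp Require Import all_classical all_reals all_analysis.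

Set Implicit Arguments.
Unset Strict Implicit.
Unset Printing Implicit Defensive.

Import Order.TTheory GRing.Theory Num.Theory.
Import numFieldNormedType.Exports.

Local Open Scope classical_set_scope.
Local Open Scope ring_scope.

Section EuclideanHausdorff.
Context {R : realType} {d : nat}.
Implicit Types (x y : 'rV[R]_d) (A : set 'rV[R]_d) (s delta : R).

(* The norm of the library on 'rV[R]_d is the sup norm, hence this definition. *)
Definition euclid_dist x y : R :=
  Num.sqrt (\sum_(i < d) (x ord0 i - y ord0 i) ^+ 2).

(* The value on the empty set is -oo. *)
Definition euclid_diam A : \bar R :=
  ereal_sup [set (euclid_dist p.1 p.2)%:E | p in A `*` A].

(* diam(A)^s with diam(set0)^s = 0 for every s, and 0^0 = 1 on singletons. *)
Definition diam_pow s A : \bar R :=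
  if A == set0 then 0%E else poweR (euclid_diam A) s.

Definition delta_covers delta A : set (nat -> set 'rV[R]_d) :=
  [set U | A `<=` \bigcup_k U k /\
           forall k, (euclid_diam (U k) <= delta%:E)%E].

Definition hausdorff_premeasure s delta A : \bar R :=
  ereal_inf [set (\sum_(0 <= k <oo) diam_pow s (U k))%E
            | U in delta_covers delta A].

(* The premeasure is nonincreasing in delta, so that the supremum over delta > 0
   is the limit as delta tends to 0. *)
Definition hausdorff_measure s A : \bar R :=
  ereal_sup [set hausdorff_premeasure s delta A | delta in [set e : R | 0 < e]].

Definition hausdorff_dim A : \bar R :=
  ereal_inf [set s%:E | s in [set s : R | 0 <= s /\ hausdorff_measure s A = 0%E]].

End EuclideanHausdorff.

Section MeanFixedSet.
Context {R : realType} {d : nat}.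
Implicit Types (x : 'rV[R]_d) (m : 'I_d -> nat).

Definition unit_cube : set 'rV[R]_d := [set x | forall i, 0 <= x ord0 i <= 1].

(* x (mod 1), in [0, 1[ *)
Definition frac_part (t : R) : R := t - (Num.floor t)%:~R.

Definition mult_mod1 m x : 'rV[R]_d :=
  \row_(i < d) frac_part ((m i)%:R * x ord0 i).

Lemma mult_mod1_cube m x : unit_cube (mult_mod1 m x).
Proof.
move=> i; rewrite mxE /frac_part subr_ge0 floor_le /=.
by rewrite lerBlDl -[X in _ + X]/(1%:~R) -intrD ltW // floorD1_gt.
Qed.

Definition orbit_mean (g : 'rV[R]_d -> 'rV[R]_d) x (n : nat) : 'rV[R]_d :=
  n%:R^-1 *: \sum_(k < n) iter k g x.

Definition mean_fixed_set (J : set 'rV[R]_d) (g : 'rV[R]_d -> 'rV[R]_d) :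
    set 'rV[R]_d :=
  [set x | J x /\ orbit_mean g x n @[n --> \oo] --> x].

End MeanFixedSet.

(* Main.v *)
(* The sum of the first [n] points of the orbit of [t] under [t |-> m t mod 1]
   is, up to a bounded error and a factor [m - 1], the sum of the first [n] digits
   of [t] in base [m].  Hence a point is fixed by the averaging as soon as, in
   each coordinate [x], the sum of the first [n] digits stays within a bounded
   distance of [n (m - 1) x].

   Such points are produced by feedback.  After a prefix that fixes [x] up to a
   small error, each new block of digits is a prescribed word or its digitwise
   complement, whichever pushes the discrepancy between the digit sum and its
   target back towards [0].  With constant words this gives density.  With a
   prefix placing [x] near [1/2], the target is close to half the maximal sum, and
   a proportion of the words of length [N] bounded below in [N] is usable.

   For the dimension, choose [L = K ^ n], blocks of about [log L / log m_i] digits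
   in the [i]-th coordinate, and [M = L / K] admissible words in every coordinate.
   Distributing the base [M] digits of [t] in [0 <= t < 1] over the coordinates gives a
   map [Phi] into the set with [|t - t'| <= c |Phi t - Phi t'| ^ s] whenever
   [L ^ s <= M ^ d], so that countable subadditivity of the Lebesgue measure on the
   line bounds the Hausdorff [s]-measure from below.  Every [s < d] is reached for
   [n] large. *)

Require Import Defs.
From mathcomp Require Import all_boot all_order all_algebra.
From mathcomp Require Import all_classical all_reals all_analysis.
From mathcomp Require Import zify ring lra.

Set Implicit Arguments.
Unset Strict Implicit.
Unset Printing Implicit Defensive.

Import Order.TTheory GRing.Theory Num.Theory.
Import numFieldNormedType.Exports.

Local Open Scope classical_set_scope.
Local Open Scope ring_scope.

(** * Digit sums and steered expansions *)

Fixpoint digit_sum (m n v : nat) : nat :=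
  if n is n'.+1 then (v %% m + digit_sum m n' (v %/ m))%N else 0%N.

(** All digits of [m ^ n - 1] are [m - 1], so the subtraction borrows nowhere and replaces each
    digit [a] by [m - 1 - a]. *)
Lemma digit_sum_compl m n v : (0 < m)%N -> (v < m ^ n)%N ->
  (digit_sum m n (m ^ n - 1 - v) + digit_sum m n v = n * (m - 1))%N.
Proof.
move=> m0; elim: n v => [|n IH] v //= vlt.
have qlt : (v %/ m < m ^ n)%N by rewrite ltn_divLR // -expnSr.
have rlt : (v %% m < m)%N by rewrite ltn_pmod.
have -> : (m ^ n.+1 - 1 - v = (m ^ n - 1 - v %/ m) * m + (m - 1 - v %% m))%N.
  rewrite {1}(divn_eq v m) expnSr.
  move: (v %/ m)%N (v %% m)%N (m ^ n)%N qlt rlt => q r t qt rm.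
  have [e ->] : exists e, t = (q + 1 + e)%N by exists (t - q - 1)%N; lia.
  have -> : (q + 1 + e - 1 - q = e)%N by lia.
  by rewrite !mulnDl mul1n; lia.
have dlt : (m - 1 - v %% m < m)%N by move: (v %% m)%N => r; lia.
rewrite modnMDl divnMDl // (modn_small dlt) (divn_small dlt) addn0.
by have := IH _ qlt; move: (v %% m)%N rlt => r; lia.
Qed.

Lemma digit_sum0 m n : digit_sum m n 0 = 0%N.
Proof. by elim: n => //= n IH; rewrite mod0n div0n. Qed.

Lemma digit_sum_cat m a b v r : (0 < m)%N -> (r < m ^ b)%N ->
  digit_sum m (b + a) (v * m ^ b + r) = (digit_sum m b r + digit_sum m a v)%N.
Proof.
move=> m0; elim: b r => [|b IH] r rlt /=.
  by move: rlt; rewrite expn0 muln1; case: r => //; rewrite addn0.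
rewrite expnSr mulnA modnMDl divnMDl // IH ?addnA //.
by rewrite ltn_divLR // -expnSr.
Qed.

Section Steering.
Context (m N P : nat) (u : nat -> nat).

(* The low block [u k] is written when the digit sum so far exceeds its target
   [k N (m - 1) x], where [x] is approximated by the current truncation
   [X / (m ^ N) ^ k.+1], and the complementary high block otherwise. *)
Fixpoint steer (k : nat) : nat * nat :=
  if k is k'.+1 then
    let: (X, s) := steer k' in
    let v := if (k' * (N * (m - 1)) * X < s * (m ^ N) ^ k)%N
             then u k' else (m ^ N - 1 - u k')%N in
    ((m ^ N * X + v)%N, (s + digit_sum m N v)%N)
  else (P, 0%N).

(** After [k] blocks the numerator has [k.+1] blocks of digits, the prefix [P] included; the digit
    sum starts at [0] and leaves the prefix out. *)
Definition trunc_num k := (steer k).1.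
Definition trunc_sum k := (steer k).2.
Definition too_big k :=
  (k * (N * (m - 1)) * trunc_num k < trunc_sum k * (m ^ N) ^ k.+1)%N.
Definition block k := if too_big k then u k else (m ^ N - 1 - u k)%N.

Lemma trunc_numS k : trunc_num k.+1 = (m ^ N * trunc_num k + block k)%N.
Proof.
by rewrite /block /too_big /trunc_num /trunc_sum /=; case: (steer k).
Qed.

Lemma trunc_sumS k : trunc_sum k.+1 = (trunc_sum k + digit_sum m N (block k))%N.
Proof.
by rewrite /block /too_big /trunc_num /trunc_sum /=; case: (steer k).
Qed.

End Steering.

Lemma eq_steer m N P u u' k : (forall j, (j < k)%N -> u j = u' j) ->
  steer m N P u k = steer m N P u' k.
Proof.
elim: k => //= k IH eqk; rewrite IH => [|j jk]; last by rewrite eqk // ltnW.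
by rewrite eqk.
Qed.

(** * Fractional parts and orbits of multiplication modulo 1 *)

Section FracPart.
Context {R : realType}.
Implicit Types (x y z : R).

Lemma frac_part_natD (n : nat) z : 0 <= z < 1 -> frac_part (n%:R + z) = z.
Proof.
move=> /andP[z0 z1]; rewrite /frac_part (@floor_def _ _ n%:Z).
  by rewrite -pmulrn addrAC subrr add0r.
by rewrite intrD -!pmulrn lerDl z0 ltrD2l.
Qed.

Lemma frac_part_itv x : 0 <= frac_part x < 1.
Proof.
have := floor_itv x; rewrite intrD mulr1z /frac_part => /andP[h1 h2].
by apply/andP; split; lra.
Qed.

Lemma frac_partM_frac (m : nat) x :
  frac_part (m%:R * frac_part x) = frac_part (m%:R * x).
Proof.
have -> : m%:R * x = m%:R * frac_part x + (m%:Z * Num.floor x)%:~R.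
  by rewrite /frac_part mulrBr intrM -pmulrn subrK.
rewrite /frac_part floorDrz ?intr_int // intrKfloor intrD.
by rewrite opprD addrACA subrr addr0.
Qed.

Lemma iter_times_mod1 (m k : nat) x : 0 <= x < 1 ->
  iter k (fun t => frac_part (m%:R * t)) x = frac_part ((m ^ k)%:R * x).
Proof.
move=> x01; elim: k => [|k IH].
  by rewrite expn0 mul1r -[x in RHS]add0r (frac_part_natD 0).
by rewrite iterS IH frac_partM_frac expnS natrM mulrA.
Qed.

(* Telescoping of [m y = digit + frac_part (m y)] along the orbit of [y]. *)
Lemma sum_frac_part (m n v : nat) z : (0 < m)%N -> (v < m ^ n)%N ->
  0 <= z < 1 ->
  let y := (v%:R + z) / (m ^ n)%:R in
  (m%:R - 1) * \sum_(j < n) frac_part ((m ^ j)%:R * y)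
    = (digit_sum m n v)%:R + z - y.
Proof.
move=> m0; elim: n v z => [|n IH] v z vlt z01 /=.
  rewrite big_ord0 mulr0 expn0 divr1.
  by move: vlt; rewrite expn0; case: v => //; rewrite !add0r subrr.
have qlt : (v %/ m < m ^ n)%N by rewrite ltn_divLR // -expnSr.
have rlt : (v %% m < m)%N by rewrite ltn_pmod.
have mR0 : (m%:R : R) != 0 by rewrite pnatr_eq0 -lt0n.
have mn0 : ((m ^ n)%:R : R) != 0 by rewrite pnatr_eq0 -lt0n expn_gt0 m0.
(* The lowest digit of [v] moves into the remainder: the induction hypothesis covers the first [n]
   terms, and the last term is [z']. *)
set z' := ((v %% m)%:R + z) / m%:R.
have z'01 : 0 <= z' < 1.
  move/andP: z01 => [z0 z1]; apply/andP; split.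
    by rewrite divr_ge0 // addr_ge0.
  rewrite ltr_pdivrMr ?ltr0n // mul1r.
  by move: rlt; rewrite -(ler_nat R) -natr1; lra.
have yE : (v%:R + z) / (m ^ n.+1)%:R = ((v %/ m)%:R + z') / (m ^ n)%:R.
  rewrite {1}(divn_eq v m) expnS natrM natrD natrM /z'; field.
  by rewrite mR0 mn0.
rewrite yE big_ord_recr /= mulrDr (IH _ _ qlt z'01) mulrCA divff // mulr1.
rewrite frac_part_natD // natrD.
have : m%:R * z' = (v %% m)%:R + z by rewrite /z' mulrCA divff // mulr1.
lra.
Qed.

End FracPart.

(** * The limit point of a steered expansion *)

Section SteeredPoint.
Context {R : realType} (m N P : nat) (u : nat -> nat).
Hypotheses (m_gt1 : (1 < m)%N) (N_gt0 : (0 < N)%N) (P_lt : (P.+1 < m ^ N)%N).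
Hypothesis u_lt : forall k, (u k < m ^ N)%N.
(** As [x] lies between [P / m ^ N] and [P.+1 / m ^ N], the two bounds put the target [N (m - 1) x]
    of one block between the digit sums of the low block and of its complement. *)
Hypothesis u_low : forall k,
  (digit_sum m N (u k) * m ^ N <= N * (m - 1) * P)%N.
Hypothesis u_high : forall k,
  (N * (m - 1) * P.+1 + digit_sum m N (u k) * m ^ N <= N * (m - 1) * m ^ N)%N.

Let X := trunc_num m N P u.
Let s := trunc_sum m N P u.
Let B := (m ^ N)%N.
Let C := (N * (m - 1))%N.

Definition steer_lim : R := sup (range (fun k => (X k)%:R / (B ^ k.+1)%:R)).
Let x := steer_lim.

Let m_gt0 : (0 < m)%N. Proof. exact: ltnW. Qed.
Let B_gt0 : (0 < B)%N. Proof. by rewrite expn_gt0 m_gt0. Qed.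
Let BX_gt0 k : (0 : R) < (B ^ k)%:R.
Proof. by rewrite ltr0n expn_gt0 B_gt0. Qed.

Lemma block_lt k : (block m N P u k < m ^ N)%N.
Proof.
by rewrite /block; case: ifP => // _; have := B_gt0; rewrite /B; lia.
Qed.

Lemma trunc_num_ge k n : (X k * B ^ n <= X (k + n))%N.
Proof.
elim: n => [|n IH]; first by rewrite muln1 addn0.
by rewrite addnS /X trunc_numS expnS -/X -/B; nia.
Qed.

Lemma trunc_num_le k n : ((X (k + n)).+1 <= (X k).+1 * B ^ n)%N.
Proof.
elim: n => [|n IH]; first by rewrite muln1 addn0.
rewrite addnS /X trunc_numS expnS -/X.
have := block_lt (k + n); rewrite -/B.
by move: (block _ _ _ _ _) (X _) (X k).+1 (B ^ n)%N IH => b a c e; nia.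
Qed.

(** The intervals from [X k / B ^ k.+1] to [(X k).+1 / B ^ k.+1] are nested, so each lower end is
    below each upper end. *)
Lemma trunc_le_trunc j k :
  (X j)%:R / (B ^ j.+1)%:R <= (X k).+1%:R / (B ^ k.+1)%:R :> R.
Proof.
rewrite ler_pdivrMr // mulrAC ler_pdivlMr // -!natrM ler_nat.
case: (leqP j k) => jk.
  have := trunc_num_ge j (k - j); rewrite subnKC // => h.
  have -> : (k.+1 = (k - j) + j.+1)%N by lia.
  by rewrite expnD mulnA leq_mul2r (leq_trans h) // orbT.
have := trunc_num_le k (j - k); rewrite (subnKC (ltnW jk)) => h.
have -> : (j.+1 = (j - k) + k.+1)%N by lia.
by rewrite expnD mulnA leq_mul2r (ltnW h) orbT.
Qed.

Lemma steer_lim_ge k : (X k)%:R / (B ^ k.+1)%:R <= x.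
Proof.
apply: ub_le_sup; last by exists k.
by exists ((X 0).+1%:R / (B ^ 1)%:R) => _ [j _ <-]; exact: trunc_le_trunc.
Qed.

Lemma steer_lim_le k : x <= (X k).+1%:R / (B ^ k.+1)%:R.
Proof.
apply: ge_sup; first by exists ((X 0)%:R / (B ^ 1)%:R); exists 0%N.
by move=> _ [j _ <-]; exact: trunc_le_trunc.
Qed.

Lemma steer_lim_itv : P%:R / B%:R <= x <= P.+1%:R / B%:R.
Proof.
by rewrite -[B]expn1; apply/andP; split;
  [exact: (steer_lim_ge 0) | exact: (steer_lim_le 0)].
Qed.

Lemma steer_lim_lt1 : 0 <= x < 1.
Proof.
have /andP[h1 h2] := steer_lim_itv; apply/andP; split.
  by apply: le_trans h1; rewrite divr_ge0.
apply: le_lt_trans h2 _.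
by rewrite ltr_pdivrMr ?mul1r ?ltr_nat // ltr0n.
Qed.

(** One [C] is the error made by testing against the truncation instead of [x], the other the
    largest overshoot of one block. The chosen block moves the discrepancy the right way, so the
    opposite bound is inherited. *)
Lemma discrepancy_le k : `|(s k)%:R - k%:R * C%:R * x| <= 2 * C%:R.
Proof.
have C0 : (0 : R) <= C%:R by [].
have [x0 x1] := andP steer_lim_lt1.
have [Px xP] := andP steer_lim_itv.
have BR0 : (0 : R) < B%:R by rewrite ltr0n.
elim: k => [|k IH]; first by rewrite !mul0r subrr normr0 mulr_ge0.
(* The truncation error is at most [1 / B ^ k.+1], and [k < B ^ k.+1]. *)
have kx : k%:R * C%:R * (x - (X k)%:R / (B ^ k.+1)%:R) <= C%:R.
  rewrite mulrAC ler_piMl //.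
  apply: (@le_trans _ _ (k%:R * (B ^ k.+1)%:R^-1)).
    rewrite ler_wpM2l // lerBlDl -[X in _ + X]mul1r -mulrDl natr1.
    exact: steer_lim_le.
  rewrite ler_pdivrMr // mul1r ler_nat.
  apply/ltnW/(ltn_trans (ltnSn k)); apply: ltn_expl.
  by apply: leq_ltn_trans P_lt.
have Xx := steer_lim_ge k.
have kC0 : 0 <= k%:R * C%:R * (x - (X k)%:R / (B ^ k.+1)%:R).
  by rewrite mulr_ge0 ?mulr_ge0 // subr_ge0.
have ulo : (digit_sum m N (u k))%:R <= C%:R * x.
  apply: le_trans (ler_wpM2l C0 Px).
  rewrite mulrA ler_pdivlMr // -!natrM ler_nat; exact: u_low.
have ulo0 : (0 : R) <= (digit_sum m N (u k))%:R by [].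
have uhi : C%:R * x <= C%:R - (digit_sum m N (u k))%:R.
  apply: le_trans (ler_wpM2l C0 xP) _.
  rewrite mulrA ler_pdivrMr // mulrBl lerBrDr -!natrM -natrD ler_nat.
  exact: u_high.
have Cx0 : 0 <= C%:R * x by rewrite mulr_ge0.
have -> : k.+1%:R * C%:R * x = k%:R * C%:R * x + C%:R * x.
  by rewrite -natr1; ring.
rewrite /s trunc_sumS natrD -/s.
move: IH; rewrite !ler_norml => /andP[IH1 IH2].
rewrite /block; case: ifP.
  rewrite /too_big -/X -/s -/C -/B -(ltr_nat R) (natrM _ (k * C)).
  rewrite (natrM _ k) (natrM _ (s k)) => tb.
  have : k%:R * C%:R * ((X k)%:R / (B ^ k.+1)%:R) < (s k)%:R :> R.
    by rewrite mulrA ltr_pdivrMr.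
  by move=> h; apply/andP; split; lra.
move/negbT; rewrite -leqNgt -/X -/s -/C -/B -(ler_nat R) (natrM _ (k * C)).
rewrite (natrM _ k) (natrM _ (s k)) => tb.
have : (s k)%:R <= k%:R * C%:R * ((X k)%:R / (B ^ k.+1)%:R) :> R.
  by rewrite mulrA ler_pdivlMr.
have := digit_sum_compl m_gt0 (u_lt k); rewrite -/B -/C.
move=> /(congr1 (fun n => n%:R : R)); rewrite natrD => h1 h2.
by apply/andP; split; lra.
Qed.

(* If the bound were attained, all later blocks would consist of the digit
   [m - 1] only, and the discrepancy would grow linearly since [x < 1]. *)
Lemma steer_lim_lt k : x < (X k).+1%:R / (B ^ k.+1)%:R.
Proof.
have [x0 x1] := andP steer_lim_lt1.
rewrite lt_neqAle steer_lim_le andbT; apply/eqP => xE.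
have XE n : ((X (k + n)).+1 = (X k).+1 * B ^ n)%N.
  apply/eqP; rewrite eqn_leq trunc_num_le /=.
  have := steer_lim_le (k + n); rewrite xE.
  rewrite ler_pdivrMr // mulrAC ler_pdivlMr // -!natrM ler_nat.
  rewrite (_ : (k + n).+1 = (n + k.+1)%N); last by lia.
  by rewrite expnD mulnA leq_pmul2r // expn_gt0 B_gt0.
have bE n : block m N P u (k + n) = (B - 1)%N.
  have := XE n.+1; rewrite addnS /X trunc_numS -/X expnS -/B.
  rewrite mulnCA -XE; nia.
have sE n : s (k + n) = (s k + n * C)%N.
  elim: n => [|n IH]; first by rewrite !addn0.
  rewrite addnS /s trunc_sumS -/s IH bE mulSn.
  have := @digit_sum_compl m N 0 m_gt0 B_gt0.
  by rewrite digit_sum0 subn0 addn0 -/B -/C => ->; lia.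
have C0 : (0 : R) < C%:R by rewrite ltr0n muln_gt0 N_gt0 subn_gt0.
(* [e] is the growth of the discrepancy per block; more than [4 C / e] blocks cannot fit between
   [- 2 C] and [2 C]. *)
pose e := C%:R * (1 - x).
have e0 : 0 < e by rewrite mulr_gt0 // subr_gt0.
have [n] : exists n : nat, 4 * C%:R / e < n%:R.
  by exists (Num.truncn (4 * C%:R / e)).+1; apply: truncnS_gt.
rewrite ltr_pdivrMr //.
have := discrepancy_le k; have := discrepancy_le (k + n).
rewrite !ler_norml sE !natrD (natrM _ n C) /e => /andP[_ h1] /andP[h2 _].
lra.
Qed.


Lemma trunc_num_lt k : (X k < B ^ k.+1)%N.
Proof.
have := steer_lim_ge k; rewrite ler_pdivrMr // => h.
rewrite -(ltr_nat R); apply: le_lt_trans h _.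
by rewrite gtr_pMl //; have /andP[] := steer_lim_lt1.
Qed.

Lemma digit_sum_trunc k :
  digit_sum m (N * k.+1) (X k) = (s k + digit_sum m N P)%N.
Proof.
elim: k => [|k IH]; first by rewrite muln1.
rewrite /X trunc_numS mulnS (mulnC (m ^ N)%N) digit_sum_cat //; last exact: block_lt.
by rewrite IH /s trunc_sumS -/s addnA; congr addn; rewrite addnC.
Qed.

(** At multiples of [N], [sum_frac_part] turns the orbit sum into a digit sum, controlled by
    [discrepancy_le]. Fewer than [N] further terms remain, each changing [W] by at most [1]. *)
Lemma steer_lim_birkhoff : exists K : R, forall n,
  `|\sum_(k < n) iter k (fun t => frac_part (m%:R * t)) x - n%:R * x| <= K.
Proof.
have x01 := steer_lim_lt1; have [x0 x1] := andP x01.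
set g := fun t => frac_part _.
pose W n := \sum_(k < n) iter k g x - n%:R * x.
have gE n : iter n g x = frac_part ((m ^ n)%:R * x) by apply: iter_times_mod1.
have WD a r : `|W (a + r)%N - W a| <= r%:R.
  elim: r => [|r IH]; first by rewrite addn0 subrr normr0.
  have -> : W (a + r.+1)%N - W a = (W (a + r)%N - W a) + (iter (a + r) g x - x).
    by rewrite addnS /W big_ord_recr /= -[(a + r).+1%:R]natr1; ring.
  apply: le_trans (ler_normD _ _) _; rewrite -natr1 lerD //.
  have := frac_part_itv ((m ^ (a + r))%:R * x); rewrite -gE => /andP[h1 h2].
  by rewrite ler_norml; apply/andP; split; lra.
have m1 : (1 : R) <= m%:R - 1.
  by rewrite lerBrDr -(natrD _ 1 1) ler_nat.
have WN k : `|W (N * k.+1)%N| <= 3 * C%:R + N%:R + 2.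
  (* Here [steer_lim_lt] gives [z < 1], so that [X k] holds the first [N * k.+1] digits of [x]. *)
  have [z [z0 z1 zE]] : exists z, [/\ 0 <= z, z < 1 &
      x = ((X k)%:R + z) / (m ^ (N * k.+1))%:R].
    exists (x * (B ^ k.+1)%:R - (X k)%:R); split.
    - by rewrite subr_ge0 -ler_pdivrMr // steer_lim_ge.
    - by rewrite ltrBlDl natr1 -ltr_pdivlMr // steer_lim_lt.
    - by rewrite addrC subrK expnM mulfK // gt_eqF.
  have Xlt : (X k < m ^ (N * k.+1))%N by rewrite expnM trunc_num_lt.
  have := sum_frac_part m_gt0 Xlt (introT andP (conj z0 z1)).
  rewrite -zE digit_sum_trunc => sumE.
  have := discrepancy_le k.
  have dP : ((digit_sum m N P)%:R : R) <= C%:R.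
    rewrite ler_nat /C -(@digit_sum_compl m N P) ?leq_addl //.
    exact: ltnW.
  have dP0 : 0 <= ((digit_sum m N P)%:R : R) by [].
  have CE : C%:R = N%:R * (m%:R - 1) :> R by rewrite /C natrM natrB.
  (* The digit sum of [P] and the term [C x] account for the prefix block, absent from
     [s k - k C x]. *)
  have : (m%:R - 1) * W (N * k.+1)%N =
     (s k)%:R - k%:R * C%:R * x + ((digit_sum m N P)%:R + z - x - C%:R * x).
    rewrite /W mulrBr; under eq_bigr do rewrite gE.
    rewrite sumE natrM CE natrD -[k.+1%:R]natr1; ring.
  have C0 : (0 : R) <= C%:R by [].
  have Cx : C%:R * x <= C%:R by rewrite ler_piMr // ltW.
  have Cx0 : 0 <= C%:R * x by rewrite mulr_ge0.
  move=> mW; rewrite ler_norml => /andP[h1 h2].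
  apply: (@le_trans _ _ `|(m%:R - 1) * W (N * k.+1)%N|).
    by rewrite normrM ger0_norm ?ler_peMl // (le_trans _ m1).
  have N0 : (0 : R) <= N%:R by [].
  by rewrite mW ler_norml; apply/andP; split; lra.
exists (3 * C%:R + N%:R + 2 + N%:R) => n; rewrite -/(W n).
have lt_mod : (n %% N < N)%N by rewrite ltn_mod.
have h := WD (n %/ N * N)%N (n %% N)%N; rewrite -divn_eq in h.
have rN : ((n %% N)%N%:R : R) <= N%:R by rewrite ler_nat ltnW.
have Wq : `|W (n %/ N * N)%N| <= 3 * C%:R + N%:R + 2.
  case: (n %/ N)%N => [|q]; last by rewrite mulnC.
  by rewrite /W big_ord0 mul0r subrr normr0 !addr_ge0 ?mulr_ge0.
rewrite -[W n](subrK (W (n %/ N * N)%N)) addrC.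
by apply: le_trans (ler_normD _ _) _; apply: lerD => //; apply: le_trans h _.
Qed.

End SteeredPoint.

(* The last digits agree, so the distinct block values are not consecutive and
   the two points cannot be close to a common endpoint. *)
Lemma steer_lim_gap {R : realType} (m N P : nat) (u u' : nat -> nat) (k : nat) :
  (1 < m)%N -> (0 < N)%N -> (P.+1 < m ^ N)%N ->
  (forall j, (u j < m ^ N)%N) -> (forall j, (u' j < m ^ N)%N) ->
  (forall j, (j < k)%N -> u j = u' j) -> u k != u' k ->
  (m %| u k)%N -> (m %| u' k)%N ->
  ((m ^ N) ^ k.+2)%:R^-1 <= `|steer_lim m N P u - steer_lim m N P u'| :> R.
Proof.
move=> m1 N0 Plt ult ult' eqk neqk mu mu'.
have m0 := ltnW m1.
have B0 : (0 : R) < ((m ^ N) ^ k.+2)%:R by rewrite ltr0n !expn_gt0 m0.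
have gap v v' : (forall j, (v j < m ^ N)%N) -> (forall j, (v' j < m ^ N)%N) ->
    (trunc_num m N P v k.+1 + 2 <= trunc_num m N P v' k.+1)%N ->
    ((m ^ N) ^ k.+2)%:R^-1 <= steer_lim m N P v' - steer_lim m N P v :> R.
  move=> vlt vlt'; rewrite -(ler_nat R) natrD => h.
  have := @steer_lim_ge R m N P v' m1 N0 Plt vlt' k.+1.
  have := @steer_lim_le R m N P v m1 N0 Plt vlt k.+1.
  rewrite ler_pdivlMr // ler_pdivrMr // -natr1 => h1 h2.
  by rewrite -[X in X <= _]mul1r ler_pdivrMr // mulrBl; lra.
have := eq_steer m N P eqk.
rewrite /= => stE.
have XE : trunc_num m N P u' k = trunc_num m N P u k by rewrite /trunc_num stE.
(* Equal histories give the same choice between word and complement, and complementing preserves the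
   difference of two words up to sign. *)
have tE : too_big m N P u' k = too_big m N P u k.
  by rewrite /too_big /trunc_num /trunc_sum stE.
have [/dvdnP[a ua] /dvdnP[b ub]] := (mu, mu').
have [ltk ltk'] := (ult k, ult' k).
have ab : (u k + 2 <= u' k \/ u' k + 2 <= u k)%N.
  by move: neqk m1; rewrite ua ub; case: (ltngtP a b) => [||-> /eqP//]; nia.
have : (trunc_num m N P u k.+1 + 2 <= trunc_num m N P u' k.+1 \/
        trunc_num m N P u' k.+1 + 2 <= trunc_num m N P u k.+1)%N.
  by rewrite !trunc_numS XE /block tE; case: ifP => _; lia.
case=> /gap h; last by apply: le_trans (h ult' ult) (ler_norm _).
by rewrite distrC; apply: le_trans (h ult ult') (ler_norm _).
Qed.

(* Either [w] or its digitwise complement, whichever has the smaller digit sum,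
   followed by the digit [0]. *)
Definition low_word (m n w : nat) : nat :=
  (m * (if 2 * digit_sum m n.+1 w <= n.+1 * (m - 1)
        then w else m ^ n.+1 - 1 - w))%N.

Section LowWord.
Context (m n : nat).
Hypothesis m_gt1 : (1 < m)%N.
Let m_gt0 : (0 < m)%N. Proof. exact: ltnW. Qed.

Lemma low_word_lt w : (w < m ^ n)%N -> (low_word m n w < m ^ n.+2)%N.
Proof.
move=> wlt; rewrite /low_word (expnS m n.+1) ltn_pmul2l //.
have : (0 < m ^ n)%N by rewrite expn_gt0 m_gt0.
by case: ifP => _; rewrite expnS; nia.
Qed.

Lemma low_word_sum w : (w < m ^ n)%N ->
  (2 * digit_sum m n.+2 (low_word m n w) <= n.+1 * (m - 1))%N.
Proof.
move=> wlt; rewrite /low_word.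
have dE v : digit_sum m n.+2 (m * v) = digit_sum m n.+1 v.
  by rewrite [LHS]/= modnMr mulKn.
have wlt' : (w < m ^ n.+1)%N by apply: leq_trans wlt _; rewrite leq_exp2l.
have := digit_sum_compl m_gt0 wlt'.
by case: ifP => h; rewrite dE; lia.
Qed.

(** Written with [n.+1] digits, [w] has leading digit [0] and its complement [m - 1], so a word
    never meets the complement of another. *)
Lemma low_word_inj w w' : (w < m ^ n)%N -> (w' < m ^ n)%N ->
  low_word m n w = low_word m n w' -> w = w'.
Proof.
move=> wlt wlt' /eqP; rewrite eqn_pmul2l // => /eqP.
by have := expnS m n; case: ifP => _; case: ifP => _; nia.
Qed.

Lemma double_le_expn N : (0 < N)%N -> (2 * N <= m ^ N)%N.
Proof.
case: N => // N _; have := ltn_expl N m_gt1.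
by rewrite expnS; nia.
Qed.

(* The hypotheses of [SteeredPoint] for the prefix [m ^ N %/ 2], which places
   the point within [1 / m ^ N] of [1 / 2]. *)
Lemma low_word_steering w (N := n.+2) (P := (m ^ N %/ 2)%N) : (w < m ^ n)%N ->
  (digit_sum m N (low_word m n w) * m ^ N <= N * (m - 1) * P)%N /\
  (N * (m - 1) * P.+1 + digit_sum m N (low_word m n w) * m ^ N
     <= N * (m - 1) * m ^ N)%N.
Proof.
move=> wlt; have := low_word_sum wlt; rewrite -/N.
(* The trailing [0] leaves the digit sum at least [(m - 1) / 2] below half the maximum [N (m - 1)];
   by this inequality the slack absorbs the rounding of [P]. *)
have BN : (2 * N <= m ^ N)%N by apply: double_le_expn.
have : (m ^ N <= 2 * P + 1)%N by rewrite /P; lia.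
have : (2 * P <= m ^ N)%N by rewrite /P; lia.
move: (digit_sum _ _ _) P BN; rewrite /N => s P.
have [c ->] : exists c, m = c.+1 by case: m m_gt1 => // c _; exists c.
rewrite subn1 /=; move: (c.+1 ^ n.+2)%N => B.
by nia.
Qed.

End LowWord.

(** * Hausdorff measure estimates *)

Section HausdorffEstimates.
Context {R : realType} {d : nat}.
Implicit Types (x y : 'rV[R]_d) (A : set 'rV[R]_d).

Lemma euclid_dist_coord x y i : `|x ord0 i - y ord0 i| <= euclid_dist x y.
Proof.
rewrite -sqrtr_sqr ler_wsqrtr // (bigD1 i) //= lerDl sumr_ge0 // => j _.
exact: sqr_ge0.
Qed.

Lemma euclid_dist_le x y e : 0 <= e ->
  (forall i, `|x ord0 i - y ord0 i| <= e) -> euclid_dist x y <= d%:R * e.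
Proof.
move=> e0 h; rewrite -[leRHS]ger0_norm ?mulr_ge0 // -sqrtr_sqr ler_wsqrtr //.
apply: (@le_trans _ _ (\sum_(i < d) e ^+ 2)).
  by apply: ler_sum => i _; rewrite -[leLHS]real_normK ?num_real // lerXn2r ?nnegrE.
rewrite sumr_const card_ord exprMn -[leLHS]mulr_natl ler_wpM2r ?sqr_ge0 //.
by rewrite -natrX ler_nat; case: (d) => // n; rewrite leq_pmulr.
Qed.

Lemma euclid_diam_ge A x y : A x -> A y ->
  ((euclid_dist x y)%:E <= euclid_diam A)%E.
Proof. by move=> Ax Ay; apply: ereal_sup_ubound; exists (x, y). Qed.

Lemma diam_pow_ge0 s A : (0 <= diam_pow s A)%E.
Proof. by rewrite /diam_pow; case: ifP => // _; exact: poweR_ge0. Qed.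

Lemma hausdorff_premeasure_ge0 s delta A : (0 <= hausdorff_premeasure s delta A)%E.
Proof.
apply: le_ereal_inf_tmp => _ [U _ <-].
by apply: nneseries_ge0 => k _ _; exact: diam_pow_ge0.
Qed.

(** The parameters sent into a covering set [U] lie in an interval of length [2 c diam(U) ^ s].
    These intervals cover [[0, 1[], so each cover has total at least [1 / (2 c)]. *)
Lemma hausdorff_measure_gt0 A s c (Phi : R -> 'rV[R]_d) : 0 <= s -> 0 < c ->
  (forall t, 0 <= t < 1 -> A (Phi t)) ->
  (forall t t', 0 <= t < 1 -> 0 <= t' < 1 ->
     `|t - t'| <= c * euclid_dist (Phi t) (Phi t') `^ s) ->
  (0 < hausdorff_measure s A)%E.
Proof.
move=> s0 c0 APhi PhiP.
apply: (@lt_le_trans _ _ (hausdorff_premeasure s 1 A)); last first.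
  by apply: ereal_sup_ubound; exists 1 => //=.
apply: (@lt_le_trans _ _ ((2 * c)^-1%:E)).
  by rewrite lte_fin invr_gt0 mulr_gt0.
apply: le_ereal_inf_tmp => _ [U [AU Udiam] <-].
(* The preimages need not be measurable, hence the enclosing sets [I]. *)
have /choice[I IP] : forall k, exists I : set R,
    [/\ measurable I, [set t | 0 <= t < 1 /\ U k (Phi t)] `<=` I &
        (lebesgue_measure I <= (2 * c)%:E * diam_pow s (U k))%E].
  move=> k.
  have [[t [t01 Ut]]|noU] := pselect (exists t, 0 <= t < 1 /\ U k (Phi t)).
    have := euclid_diam_ge Ut Ut; have := Udiam k.
    case diamE : (euclid_diam (U k)) => [r| |] //= r1.
    rewrite lee_fin => r0.
    have {}r0 : 0 <= r by apply: le_trans r0; exact: sqrtr_ge0.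
    exists `[t - c * r `^ s, t + c * r `^ s]%classic; split => //.
      move=> t' [t'01 Ut']; rewrite /= in_itv /= -ler_distl distrC.
      apply: le_trans (PhiP _ _ t01 t'01) _; rewrite ler_pM2l //.
      apply: ge0_ler_powR => //; rewrite ?nnegrE ?sqrtr_ge0 //.
      by have := euclid_diam_ge Ut Ut'; rewrite diamE lee_fin.
    rewrite /diam_pow; case: ifPn => [/eqP U0|_].
      by move: Ut; rewrite U0.
    rewrite diamE /= lebesgue_measure_itv /=.
    have cr0 : 0 <= c * r `^ s by rewrite mulr_ge0 ?powR_ge0 // ltW.
    case: ifP => _; last by rewrite lee_fin -mulrA mulr_ge0.
    by rewrite -EFinB -EFinM lee_fin; lra.
  exists set0; split => //; first by move=> t h; apply: noU; exists t.
  by rewrite measure0 mule_ge0 ?diam_pow_ge0 // lee_fin mulr_ge0 // ltW.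
have : (lebesgue_measure `[0%R, 1%R[%classic <=
        \sum_(0 <= k <oo) lebesgue_measure (I k))%E.
  apply: measure_sigma_subadditive => //; first by move=> k; case: (IP k).
  move=> t /=; rewrite in_itv /= => t01.
  by have [k _ Ut] := AU _ (APhi _ t01); exists k => //; case: (IP k) => _ + _; apply.
rewrite lebesgue_measure_itv /= lte_fin ltr01 sube0 => le1.
have : (1 <= (2 * c)%:E * \sum_(0 <= k <oo) diam_pow s (U k))%E.
  rewrite -nneseriesZl; last by move=> k _; exact: diam_pow_ge0.
  apply: le_trans le1 _; apply: lee_nneseries => [k _ _|k _].
    exact: measure_ge0.
  by case: (IP k).
by rewrite -lee_pdivrMl ?mulr_gt0 // mule1.
Qed.

Lemma hausdorff_premeasure_le_finite (T : finType) (V : T -> set 'rV[R]_d)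
    A s delta r : 0 <= s -> 0 <= r <= delta -> A `<=` \bigcup_f V f ->
  (forall f x y, V f x -> V f y -> euclid_dist x y <= r) ->
  (hausdorff_premeasure s delta A <= (#|T|%:R * r `^ s)%:E)%E.
Proof.
move=> s0 /andP[r0 rdelta] AV Vr.
(* Padding with [set0] is free: its [diam_pow] is [0] even for [s = 0]. *)
pose U k := if insub k : option 'I_#|T| is Some i then V (enum_val i) else set0.
have Udiam k : (euclid_diam (U k) <= r%:E)%E.
  apply: ge_ereal_sup => _ [[x y] [/= Ux Uy] <-]; rewrite lee_fin.
  by move: Ux Uy; rewrite /U; case: insub => // i; exact: Vr.
apply: ge_ereal_inf; exists (\sum_(0 <= k <oo) diam_pow s (U k))%E.
  exists U => //; split=> [x Ax|k]; last first.
    by apply: le_trans (Udiam k) _; rewrite lee_fin.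
  have [f _ Vfx] := AV _ Ax; exists (enum_rank f) => //.
  by rewrite /U valK enum_rankK.
rewrite (nneseries_split 0 #|T|); last by move=> k _; exact: diam_pow_ge0.
rewrite eseries0 ?adde0; last first.
  move=> k kT _; rewrite /diam_pow /U insubF ?eqxx //.
  by apply/negbTE; rewrite -leqNgt.
apply: (@le_trans _ _ (\sum_(0 <= k < 0 + #|T|) (r `^ s)%:E)%E).
  apply: lee_sum => k _; rewrite /diam_pow; case: ifPn => [_|/set0P[x Ux]].
    by rewrite lee_fin powR_ge0.
  have := euclid_diam_ge Ux Ux; have := Udiam k.
  case: (euclid_diam (U k)) => [q| |] //=; rewrite !lee_fin => qr q0.
  have {}q0 : 0 <= q by apply: le_trans q0; exact: sqrtr_ge0.
  by apply: ge0_ler_powR; rewrite ?nnegrE.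
by rewrite sumEFin sumr_const_nat subn0 add0n mulr_natl.
Qed.

(** A grid of [q.+1 ^ d] cells of diameter at most [2 d / q.+1] has total at most
    [c q.+1 ^ (d - s)], which is small for large [q]. *)
Lemma hausdorff_measure_cube0 A s : A `<=` unit_cube -> d%:R < s ->
  hausdorff_measure s A = 0%E.
Proof.
move=> Acube ds; have s0 : 0 <= s by apply: le_trans (ltW ds).
apply/eqP; rewrite eq_le; apply/andP; split; last first.
  apply: le_trans (hausdorff_premeasure_ge0 s 1 A) _.
  by apply: ereal_sup_ubound; exists 1 => //=.
apply: ge_ereal_sup => _ [delta /= delta0 <-].
apply/lee_addgt0Pr => e e0; rewrite add0e.
set c : R := (2 * d%:R) `^ s.
have c0 : 0 <= c by exact: powR_ge0.
have sd0 : 0 < s - d%:R by rewrite subr_gt0.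
(* Chosen so that [b ^ (s - d) = c / e]; below, the summand [2 d / delta] makes the cells finer than
   [delta]. *)
pose b := ((c / e) `^ (s - d%:R)^-1).
have b0 : 0 <= b by exact: powR_ge0.
have [q qgt] : exists q : nat, b + 2 * d%:R / delta < q%:R.
  by exists (Num.truncn (b + 2 * d%:R / delta)).+1; apply: truncnS_gt.
have d2 : 0 <= 2 * d%:R / delta by rewrite divr_ge0 ?mulr_ge0 // ltW.
have q0 : 0 < q%:R :> R by apply: le_lt_trans qgt; rewrite addr_ge0.
(* Half-open cells of side [1 / q]; the index [q] is for the coordinate [1]. In [r], the bound
   [1 / q <= 2 / q.+1] makes diameter and cell count powers of the same number. *)
pose V (f : {ffun 'I_d -> 'I_q.+1}) : set 'rV[R]_d :=
  [set x | forall i, (f i)%:R <= q%:R * x ord0 i < (f i).+1%:R].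
pose r := 2 * d%:R / q.+1%:R : R.
have r0 : 0 <= r by rewrite divr_ge0 ?mulr_ge0.
have : (hausdorff_premeasure s delta A <=
        (#|{ffun 'I_d -> 'I_q.+1}|%:R * r `^ s)%:E)%E.
  apply: (@hausdorff_premeasure_le_finite _ V) => //.
  - rewrite r0 ler_pdivrMr // (mulrC delta) -ler_pdivrMr //.
    apply: (@le_trans _ _ q%:R); last by rewrite ler_nat.
    by apply/ltW/le_lt_trans/qgt; rewrite lerDr.
  - move=> x /Acube xc.
    have xq i : (Num.truncn (q%:R * x ord0 i) < q.+1)%N.
      have /andP[x0 x1] := xc i.
      have qx0 : 0 <= q%:R * x ord0 i by rewrite mulr_ge0.
      rewrite ltnS -(ler_nat R); apply: (@le_trans _ _ (q%:R * x ord0 i)).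
        by rewrite truncn_le.
      by rewrite ler_piMr.
    exists [ffun i => Ordinal (xq i)] => // i; rewrite ffunE /=.
    by apply: truncn_itv; rewrite mulr_ge0 //; case/andP: (xc i).
  - move=> f x y Vx Vy; rewrite /r mulrAC mulrC.
    apply: euclid_dist_le; first by rewrite divr_ge0.
    move=> i; have /andP[x1 x2] := Vx i; have /andP[y1 y2] := Vy i.
    apply: (@le_trans _ _ (q%:R^-1)).
      rewrite -[leRHS]mul1r ler_pdivlMr // -[X in _ * X]ger0_norm // -normrM mulrBl.
      rewrite ler_norml.
      by move: x2 y2; rewrite -!natr1 => x2 y2; apply/andP; split; lra.
    rewrite ler_pdivlMr // mulrC ler_pdivrMr // -natrM ler_nat.
    by move: q0; rewrite ltr0n; lia.
move=> /le_trans; apply; rewrite lee_fin card_ffun !card_ord.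
have p0 : (0 : R) < q.+1%:R by [].
have rE : r `^ s = c * q.+1%:R `^ (- s).
  by rewrite /r powRM ?mulr_ge0 ?invr_ge0 // -/c -powR_inv1 // -powRrM mulN1r.
have -> : ((q.+1 ^ d)%:R : R) = q.+1%:R `^ d%:R by rewrite natrX powR_mulrn.
rewrite rE mulrCA -powRD; last by apply/implyP => _; rewrite gt_eqF.
rewrite -opprB powRN ler_pdivrMr ?powR_gt0 // (mulrC e) -ler_pdivrMr //.
have -> : c / e = b `^ (s - d%:R).
  by rewrite /b -powRrM mulVf ?gt_eqF // powRr1 // divr_ge0 // ltW.
apply: ge0_ler_powR; rewrite ?nnegrE //; first exact: ltW.
apply: (@le_trans _ _ q%:R); last by rewrite ler_nat.
by apply/ltW/(le_lt_trans _ qgt); rewrite lerDl.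
Qed.

End HausdorffEstimates.

(** * The mean fixed set in the cube *)

Section BaseExpansion.
Context {R : realType} (b : nat).
Hypothesis b_gt0 : (0 < b)%N.
Implicit Types t : R.

Definition base_trunc t n := Num.truncn ((b ^ n)%:R * t).

Lemma base_trunc_itv t n : 0 <= t ->
  (base_trunc t n)%:R <= (b ^ n)%:R * t < (base_trunc t n).+1%:R.
Proof. by move=> t0; apply: truncn_itv; rewrite mulr_ge0. Qed.

Lemma base_truncS_div t n : 0 <= t -> (base_trunc t n.+1 %/ b = base_trunc t n)%N.
Proof.
move=> t0; apply/esym/truncn_def; have := base_trunc_itv n.+1 t0.
have b0 : (0 : R) < b%:R by rewrite ltr0n.
move: (base_trunc t n.+1) => T; rewrite expnS natrM -mulrA => /andP[h1 h2].
apply/andP; split.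
  by rewrite -(ler_pM2l b0); apply: le_trans h1; rewrite -natrM ler_nat mulnC leq_divM.
rewrite -(ltr_pM2l b0); apply: lt_le_trans h2 _.
by rewrite -natrM ler_nat mulnC ltn_ceil.
Qed.

(** [base_trunc t j.+1] modulo [b] is the digit of [t] of index [j]. *)
Lemma eq_base_trunc t t' n : 0 <= t < 1 -> 0 <= t' < 1 ->
  (forall j, (j < n)%N -> base_trunc t j.+1 = base_trunc t' j.+1 %[mod b]) ->
  base_trunc t n = base_trunc t' n.
Proof.
move=> t01 t'01; elim: n => [_|n IH eqj].
  by rewrite /base_trunc !mul1r (@truncn_def _ t 0 t01) (@truncn_def _ _ 0 t'01).
rewrite (divn_eq (base_trunc t _) b) (divn_eq (base_trunc t' _) b).
rewrite eqj // !base_truncS_div ?IH //; first by move=> j jn; apply/eqj/ltnW.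
- by case/andP: t'01.
- by case/andP: t01.
Qed.

Lemma eq_base_trunc_dist t t' n : 0 <= t -> 0 <= t' ->
  base_trunc t n = base_trunc t' n -> `|t - t'| <= (b ^ n)%:R^-1.
Proof.
move=> t0 t'0 eqT; have := base_trunc_itv n t0; have := base_trunc_itv n t'0.
have bn0 : (0 : R) < (b ^ n)%:R by rewrite ltr0n expn_gt0 b_gt0.
rewrite eqT -natr1 => /andP[h1 h2] /andP[h3 h4].
rewrite -[leRHS]mul1r ler_pdivlMr // -[X in _ * X]ger0_norm // -normrM mulrBl.
by rewrite ler_norml; apply/andP; split; lra.
Qed.

End BaseExpansion.

Section Cube.
Context {R : realType} {d : nat} (m : 'I_d -> nat).

Lemma iter_mult_mod1 k (x : 'rV[R]_d) i :
  iter k (mult_mod1 m) x ord0 i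
    = iter k (fun t => frac_part ((m i)%:R * t)) (x ord0 i).
Proof. by elim: k => //= k IH; rewrite mxE IH. Qed.

Lemma rV_norm_le (v : 'rV[R]_d) e : 0 <= e ->
  (forall i, `|v ord0 i| <= e) -> `|v| <= e.
Proof.
move=> e0 h; rewrite /Num.norm /= mx_normrE; apply/bigmax_leP; split => // -[i j] _.
by rewrite /= ord1.
Qed.

(** Dividing a bounded discrepancy by [n] gives convergence; the sum [S] of the bounds serves all
    coordinates at once. *)
Lemma mean_fixed_bounded (x : 'rV[R]_d) : unit_cube x ->
  (forall i, exists K : R, forall n,
     `|\sum_(k < n) iter k (fun t => frac_part ((m i)%:R * t)) (x ord0 i)
       - n%:R * x ord0 i| <= K) ->
  mean_fixed_set unit_cube (mult_mod1 m) x.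
Proof.
move=> xJ /choice[K KP]; split => //.
have K0 i : 0 <= K i by apply: le_trans (KP i 0%N).
apply/cvgrPdist_le => e e0; pose S := \sum_i K i.
have S0 : 0 <= S by apply: sumr_ge0.
exists (Num.truncn (S / e)).+1 => // n /= Sn.
have {}Sn : S / e < n%:R by apply: lt_le_trans (truncnS_gt _) _; rewrite ler_nat.
have n0 : 0 < n%:R :> R by apply: le_lt_trans Sn; rewrite divr_ge0 // ltW.
apply: rV_norm_le => [|i]; first exact: ltW.
rewrite !mxE summxE; under eq_bigr do rewrite iter_mult_mod1.
rewrite -(ler_pM2l n0) -[X in X * `|_|]ger0_norm // -normrM mulrBr mulrA.
rewrite divff ?gt_eqF // mul1r distrC.
apply: le_trans (KP i n) _; apply: (@le_trans _ _ S).
  by rewrite /S (bigD1 i) //= lerDl sumr_ge0.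
by rewrite -ler_pdivrMr // ltW.
Qed.

Hypothesis m_ge2 : forall i, (2 <= m i)%N.

Lemma steered_mean_fixed (N P : 'I_d -> nat) (u : 'I_d -> nat -> nat) :
  (forall i, 0 < N i)%N -> (forall i, (P i).+1 < m i ^ N i)%N ->
  (forall i k, u i k < m i ^ N i)%N ->
  (forall i k, digit_sum (m i) (N i) (u i k) * m i ^ N i
                 <= N i * (m i - 1) * P i)%N ->
  (forall i k, N i * (m i - 1) * (P i).+1
                 + digit_sum (m i) (N i) (u i k) * m i ^ N i
                 <= N i * (m i - 1) * m i ^ N i)%N ->
  mean_fixed_set unit_cube (mult_mod1 m)
    (\row_i steer_lim (m i) (N i) (P i) (u i) : 'rV[R]_d).
Proof.
move=> N0 Plt ult ulow uhigh; apply: mean_fixed_bounded => i; rewrite mxE.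
  by have /andP[-> /ltW] := @steer_lim_lt1 R _ _ _ _ (m_ge2 i) (N0 i) (Plt i) (ult i).
exact: steer_lim_birkhoff.
Qed.

(** The word [0] has digit sum [0] and its complement the maximal one, so every admissible prefix
    can be steered. *)
Lemma mean_fixed_dense :
  unit_cube `<=` closure (mean_fixed_set (@unit_cube R d) (mult_mod1 m)).
Proof.
move=> y yJ B /nbhs_ballP[e /= e0 eB].
pose N := (Num.truncn (2 / e)).+2.
pose b i := (m i ^ N)%N.
have Nb i : (N < b i)%N by apply: ltn_expl; exact: m_ge2.
(* The cap keeps [(P i).+1 < b i] when the coordinate is at or near [1], at the price of an error
   [2 / b i]. *)
pose P i := minn (Num.truncn ((b i)%:R * y ord0 i)) (b i - 2).
pose z : 'rV[R]_d := \row_i steer_lim (m i) N (P i) (fun=> 0%N).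
have Plt i : ((P i).+1 < b i)%N by have := Nb i; rewrite /P /N; lia.
have b0 i : (0 < b i)%N by apply: leq_ltn_trans (Nb i).
exists z; split.
  apply: steered_mean_fixed => // i k; first exact: b0.
    by rewrite digit_sum0 mul0n.
  by rewrite digit_sum0 mul0n addn0 leq_mul2l (ltnW (Plt i)) orbT.
apply: eB; rewrite -ball_normE /=.
apply: (@le_lt_trans _ _ (2 / N%:R)); last first.
  rewrite ltr_pdivrMr // mulrC -ltr_pdivrMr //.
  by apply: lt_le_trans (truncnS_gt _) _; rewrite ler_nat.
apply: rV_norm_le => [|i]; first by rewrite divr_ge0.
rewrite !mxE.
have bR : 0 < (b i)%:R :> R by rewrite ltr0n.
have := @steer_lim_itv R (m i) N (P i) (fun=> 0%N) (m_ge2 i) isT (Plt i) (fun=> b0 i).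
rewrite -/(b i) ler_pdivrMr // ler_pdivlMr // => /andP[h1 h2].
have /andP[y0 y1] := yJ i.
have by0 : 0 <= (b i)%:R * y ord0 i by rewrite mulr_ge0.
have /andP[h3 h4] := truncn_itv by0.
have h5 : (P i)%:R <= (b i)%:R * y ord0 i.
  by apply: le_trans h3; rewrite ler_nat geq_minl.
have h6 : (b i)%:R * y ord0 i <= (P i)%:R + 2.
  rewrite /P /minn; case: ifP => _; first by rewrite -natr1 in h4; lra.
  rewrite -natrD subnK; last by apply: leq_trans (Nb i); rewrite /N.
  by rewrite ler_piMr.
apply: (@le_trans _ _ (2 / (b i)%:R)); last first.
  by rewrite ler_pM2l // lef_pV2 ?posrE // ler_nat ltnW.
rewrite ler_pdivlMr // -[X in _ * X]ger0_norm // -normrM mulrBl.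
by move: h2; rewrite -natr1 => h2; rewrite ler_norml; apply/andP; split; lra.
Qed.

End Cube.

(** If the digits of [t] and [t'] first differ in round [k], then [|t - t'| <= M ^ (- k d)], while
    the images are at least [L ^ (- (k + 2))] apart. *)
Lemma mean_fixed_measure_gt0 {R : realType} (d : nat) (m : 'I_d -> nat) (s : R) :
  (1 <= d)%N -> (forall i, (2 <= m i)%N) -> 0 <= s < d%:R ->
  (0 < hausdorff_measure s (mean_fixed_set (@unit_cube R d) (mult_mod1 m)))%E.
Proof.
move=> d0 m2 /andP[s0 sd].
(* The factor [K = L / M] pays for three digits: the two reserved by [low_word] and one lost in
   rounding the logarithm. *)
have [K mK K2] : exists2 K, (forall i, m i ^ 3 <= K)%N & (2 <= K)%N.
  have mK i : (m i ^ 3 <= (\sum_j m j) ^ 3)%N.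
    by rewrite leq_exp2r // (bigD1 i) //= leq_addr.
  exists ((\sum_j m j) ^ 3)%N => //; apply: leq_trans (mK (Ordinal d0)).
  by apply: leq_trans (m2 (Ordinal d0)) _; rewrite -[leqLHS]expn1 leq_exp2l.
(* Equivalent to [(n + 2) s <= (n + 1) d], the exponent form of [L ^ s <= M ^ d]. *)
have [n nds] : exists n : nat, d%:R <= n.+2%:R * (d%:R - s).
  exists (Num.truncn (d%:R / (d%:R - s))); rewrite -ler_pdivrMr ?subr_gt0 //.
  by apply: ltW; apply: lt_le_trans (truncnS_gt _) _; rewrite ler_nat.
pose L := (K ^ n.+2)%N; pose M := (K ^ n.+1)%N.
have L0 : (0 < L)%N by rewrite expn_gt0 (ltnW K2).
have M2 : (1 < M)%N.
  by apply: (leq_trans K2); rewrite /M -[leqLHS]expn1 leq_exp2l.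
have M0 := ltnW M2.
have LsM : L%:R `^ s <= (M ^ d)%:R :> R.
  rewrite /L /M -expnM !natrX -!powR_mulrn // -powRrM.
  apply: ler_powR; first by rewrite ler1n ltnW.
  by rewrite natrM; move: nds; rewrite -!natr1; lra.
pose p i := (trunc_log (m i) L - 2)%N.
pose N i := (p i).+2.
have N0 i : (0 < N i)%N by [].
have NE i : N i = trunc_log (m i) L.
  rewrite /N /p; suff : (2 <= trunc_log (m i) L)%N by lia.
  apply: trunc_log_max; first exact: m2.
  apply: (@leq_trans K).
    by apply: leq_trans (mK i); rewrite leq_exp2l //; exact: m2.
  by rewrite /L -[leqLHS]expn1 leq_exp2l.
have BL i : (m i ^ N i <= L)%N by rewrite NE trunc_logP //; exact: m2.
have Mp i : (M <= m i ^ p i)%N.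
  have := trunc_log_ltn L (m2 i); rewrite -NE.
  have -> : ((N i).+1 = p i + 3)%N by rewrite /N addn3.
  rewrite expnD /L expnS -/M => h.
  rewrite leqNgt; apply/negP => h'; move: h; rewrite ltnNge => /negP; apply.
  by rewrite mulnC leq_mul // ltnW.
(* Round [k] spends the [d] digits of [t] from index [k d] on, one per coordinate. *)
pose w (t : R) (i : 'I_d) k := (base_trunc M t (k * d + i).+1 %% M)%N.
have wlt t i k : (w t i k < m i ^ p i)%N by apply: leq_trans (Mp i); rewrite ltn_mod.
pose u t i k := low_word (m i) (p i) (w t i k).
pose P i := (m i ^ N i %/ 2)%N.
pose Phi t : 'rV[R]_d := \row_i steer_lim (m i) (N i) (P i) (u t i).
have ult t i k : (u t i k < m i ^ N i)%N by apply: low_word_lt => //; exact: m2.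
have Plt i : ((P i).+1 < m i ^ N i)%N.
  by have := @double_le_expn (m i) (m2 i) (N i) isT; rewrite /P /N; lia.
have PhiF t : mean_fixed_set unit_cube (mult_mod1 m) (Phi t).
  apply: steered_mean_fixed => // i k;
    by have [] := low_word_steering (m2 i) (wlt t i k).
(* The factor [L ^ 2] makes up for the exponent [k.+2], instead of [k], in [steer_lim_gap]. *)
apply: (@hausdorff_measure_gt0 R d _ s ((L ^ 2)%:R `^ s) Phi) => //.
  by rewrite powR_gt0 // ltr0n expn_gt0 L0.
move=> t t' t01 t'01; have [t0 _] := andP t01; have [t'0 _] := andP t'01.
have [->|tt'] := eqVneq t t'.
  by rewrite subrr normr0 mulr_ge0 ?powR_ge0.
have dist0 : 0 < `|t - t'| by rewrite normr_gt0 subr_eq0.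
have ex_neq : exists k, [exists i, w t i k != w t' i k].
  apply: contrapT => noex.
  have eqw k i : w t i k = w t' i k.
    by apply: contra_notP noex => /eqP neq; exists k; apply/existsP; exists i.
  (* Since [M ^ q > q > 1 / |t - t'|], agreement of the first [q] digits is already impossible. *)
  pose q := (Num.truncn `|t - t'|^-1).+1.
  have : `|t - t'| <= (M ^ q)%:R^-1.
    apply: eq_base_trunc_dist => //; apply: eq_base_trunc => // j _.
    by have := eqw (j %/ d)%N (Ordinal (ltn_pmod j d0)); rewrite /w /= -divn_eq.
  rewrite leNgt => /negP; apply.
  have Mq : (0 : R) < (M ^ q)%:R by rewrite ltr0n expn_gt0 M0.
  rewrite invf_plt ?posrE //.
  by apply: lt_le_trans (truncnS_gt _) _; rewrite ler_nat ltnW // ltn_expl.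
have [k /existsP[i wk] kmin] := ex_minnP ex_neq.
have eqw j i' : (j < k)%N -> w t i' j = w t' i' j.
  move=> jk; apply/eqP/negPn/negP => neq.
  by have := kmin j; rewrite leqNgt jk => /(_ (introT existsP (ex_intro _ i' neq))).
have le1 : `|t - t'| <= (M ^ (k * d))%:R^-1.
  apply: eq_base_trunc_dist => //; apply: eq_base_trunc => // j jk.
  have jd : (j %/ d < k)%N by rewrite ltn_divLR.
  by have := eqw _ (Ordinal (ltn_pmod j d0)) jd; rewrite /w /= -divn_eq.
have gap : ((m i ^ N i) ^ k.+2)%:R^-1 <= euclid_dist (Phi t) (Phi t').
  apply: le_trans (euclid_dist_coord _ _ i); rewrite !mxE.
  apply: (steer_lim_gap (m2 i) (N0 i) (Plt i) (ult t i) (ult t' i)).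
  - by move=> j jk; rewrite /u eqw.
  - by apply: contra wk => /eqP /(low_word_inj (m2 i) (wlt _ _ _) (wlt _ _ _)) ->.
  - exact: dvdn_mulr.
  - exact: dvdn_mulr.
have LR0 : 0 < L%:R :> R by rewrite ltr0n.
have Lk : (L ^ k)%:R^-1 <= (L ^ 2)%:R * euclid_dist (Phi t) (Phi t').
  apply: (@le_trans _ _ ((L ^ 2)%:R * (L ^ k.+2)%:R^-1)).
    rewrite -[k.+2]add2n expnD natrM invfM mulrA divff ?mul1r //.
    by rewrite gt_eqF // ltr0n expn_gt0 L0.
  rewrite ler_wpM2l //; apply: le_trans gap.
  have Lk0 : (0 : R) < (L ^ k.+2)%:R by rewrite ltr0n expn_gt0 L0.
  have Bk0 : (0 : R) < ((m i ^ N i) ^ k.+2)%:R.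
    by rewrite ltr0n !expn_gt0 (ltnW (m2 i)).
  by rewrite lef_pV2 ?posrE // ler_nat leq_exp2r.
rewrite -powRM //; last exact: sqrtr_ge0.
apply: le_trans le1 _; apply: (@le_trans _ _ ((L ^ k)%:R^-1 `^ s)); last first.
  apply: ge0_ler_powR => //; rewrite nnegrE ?invr_ge0 //.
  by rewrite mulr_ge0 ?sqrtr_ge0.
(* What remains is the [k]-th power of [LsM]. *)
rewrite -powR_inv1 // -powRrM mulN1r powRN lef_pV2 ?posrE; last 2 first.
- by rewrite ltr0n expn_gt0 M0.
- by rewrite powR_gt0 // ltr0n expn_gt0 L0.
rewrite natrX -powR_mulrn // -powRrM mulrC powRrM powR_mulrn ?powR_ge0 //.
by rewrite mulnC expnM natrX lerXn2r // ?nnegrE ?powR_ge0.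
Qed.

Theorem theorem3p4 (R : realType) (d : nat) (hd : (1 <= d)%N)
    (m : 'I_d -> nat) (hm : forall i, (2 <= m i)%N) :
  let J := @unit_cube R d in
  let g := @mult_mod1 R d m in
  J `<=` closure (mean_fixed_set J g) /\
  hausdorff_dim (mean_fixed_set J g) = (d%:R)%:E.
Proof.
move=> J g; split; first exact: mean_fixed_dense.
have FJ : mean_fixed_set J g `<=` unit_cube by move=> x [].
apply/eqP; rewrite eq_le; apply/andP; split.
  apply/lee_addgt0Pr => e e0; apply: ereal_inf_lbound.
  exists (d%:R + e) => //; split; first by rewrite addr_ge0 // ltW.
  by apply: hausdorff_measure_cube0 FJ _; rewrite ltrDl.
apply: le_ereal_inf_tmp => _ [s [s0 Hs0] <-]; rewrite lee_fin leNgt.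
apply/negP => sd; have := @mean_fixed_measure_gt0 R d m s hd hm.
by rewrite s0 sd Hs0 ltxx => /(_ isT).
Qed.
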